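(* Let $L:\mathbb{R}^n\times\mathbb{R}^m\to[-\infty,+\infty]$ be such that $L(\cdot,\lambda)$ is convex and lower semicontinuous for every $\lambda$ and $L(x,\cdot)$ is concave and upper semicontinuous for every $x$. Let $\eta>0$ and let $z^k=(x^k,\lambda^k)$, $k\ge0$, be generated by the proximal point method (PPM) $$(x^{k+1},\lambda^{k+1})=\arg\min_x\arg\max_\lambda\Big\{L(x,\lambda)+\tfrac1{2\eta}\|x-x^k\|_2^2-\tfrac1{2\eta}\|\lambda-\lambda^k\|_2^2\Big\}.$$ Set $\bar z^k=(\bar x^k,\bar\lambda^k)=\frac1k\sum_{i=1}^kz^i$. Then for every $k\ge1$ and every $z=(x,\lambda)\in\mathbb{R}^n\times\mathbb{R}^m$, $$L(\bar x^k,\lambda)-L(x,\bar\lambda^k)\le\frac{\|z-z^0\|_2^2}{2\eta k}.$$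
   Context: The $\arg\min_x\arg\max_\lambda$ in the PPM update denotes a saddle point, with finite value, of the regularized function in braces (minimum in $x$, maximum in $\lambda$); the update is assumed to be well defined. *)

(* Defs.v *)
From HB Require Import structures.
From mathcomp Require Import all_boot all_order all_algebra.
From mathcomp Require Import all_classical all_reals all_analysis.

Set Implicit Arguments.
Unset Strict Implicit.
Unset Printing Implicit Defensive.

Import Order.TTheory GRing.Theory Num.Theory.
Import numFieldNormedType.Exports.

Local Open Scope classical_set_scope.
Local Open Scope ring_scope.

(* The library norm on ['rV[R]_n] is the sup norm, hence this definition. *)
Definition norm2 (R : realType) (n : nat) (v : 'rV[R]_n) : R :=
  Num.sqrt (\sum_(i < n) v 0 i ^+ 2).

(* The values -oo and +oo are both allowed, so that a convex combination of
   values of [f] may be undefined; convexity is that of the epigraph. *)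
Definition ereal_convex (R : realType) (n : nat) (f : 'rV[R]_n -> \bar R) :=
  convex_set [set p : 'rV[R]_n * R^o | (f p.1 <= (p.2 : R)%:E)%E].

Definition ereal_concave (R : realType) (n : nat) (f : 'rV[R]_n -> \bar R) :=
  ereal_convex (fun x => - f x)%E.

Definition upper_semicontinuous (R : realType) (T : topologicalType)
    (f : T -> \bar R) :=
  lower_semicontinuous (fun x => - f x)%E.

Definition saddle_point (R : realType) (X Y : Type) (F : X -> Y -> \bar R)
    (x0 : X) (y0 : Y) : Prop :=
  forall x y, (F x0 y <= F x0 y0 /\ F x0 y0 <= F x y0)%E.

Definition ppm_objective (R : realType) (n m : nat)
    (L : 'rV[R]_n -> 'rV[R]_m -> \bar R) (eta : R)
    (xk : 'rV[R]_n) (lk : 'rV[R]_m) (x : 'rV[R]_n) (l : 'rV[R]_m) : \bar R :=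
  (L x l + (1 / (2 * eta) * norm2 (x - xk) ^+ 2)%:E
         - (1 / (2 * eta) * norm2 (l - lk) ^+ 2)%:E)%E.

(* The saddle point is unique whenever it exists with a finite value, by strict
   convexity-concavity, so this relation is the equation
   (x', l') = argmin argmax. *)
Definition ppm_step (R : realType) (n m : nat)
    (L : 'rV[R]_n -> 'rV[R]_m -> \bar R) (eta : R)
    (xk : 'rV[R]_n) (lk : 'rV[R]_m) (x' : 'rV[R]_n) (l' : 'rV[R]_m) : Prop :=
  saddle_point (ppm_objective L eta xk lk) x' l' /\
  ppm_objective L eta xk lk x' l' \is a fin_num.

Definition avg_iter (R : realType) (n : nat) (u : nat -> 'rV[R]_n) (k : nat) :
    'rV[R]_n :=
  k%:R^-1 *: \sum_(1 <= i < k.+1) u i.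

(* Main.v *)
Require Import Defs.
From HB Require Import structures.
From mathcomp Require Import all_boot all_order all_algebra.
From mathcomp Require Import all_classical all_reals all_analysis.
From mathcomp Require Import ring lra.
Import Order.TTheory GRing.Theory Num.Theory.
Import numFieldNormedType.Exports.
Local Open Scope classical_set_scope.
Local Open Scope ring_scope.

(** Each step of the method satisfies a one-step gap inequality, and the gap
    inequalities telescope along the run.

    Fix a step from [z = (y, w)] to [z' = (x', l')] and put [a = 1/(2 eta)].
    The saddle value is finite, so [c = L x' l'] is a real number, and the two
    halves of the saddle condition say that [x'] minimizes
    [L(., l') + a |. - y|^2] and that [l'] minimizes [- L(x', .) + a |. - w|^2].
    A convex function plus a quadratic of curvature [2 a] grows at least like
    [a |. - x'|^2] away from its minimizer ([prox_gap]); hence, for all [x]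
    and [l],
      [c - a (|x - y|^2 - |x - x'|^2) <= L x l']  and
      [L x' l <= c + a (|l - w|^2 - |l - l'|^2)]  ([ppm_step_gap]).
    Both bounds are real numbers, even where [L] itself is infinite.

    Averaging over the first [k] steps, convexity of the epigraph of
    [L(., l)] and of [- L(x, .)] ([epigraph_avg]) turns these pointwise bounds
    into an upper bound for [L] at the averaged primal point and a lower bound
    at the averaged dual point. The values [c] cancel in the difference, and
    the squared distances, with factor [a / k], telescope
    ([sum_telescope_decr]) to
    [|z - z^0|^2 - |z - z^k|^2 <= |z - z^0|^2]. Both averaged bounds being real, the
    difference is never of the form oo - oo. *)

(** * Squared Euclidean norm *)

Lemma sqr_norm2 (R : realType) (n : nat) (v : 'rV[R]_n) :
  norm2 v ^+ 2 = \sum_(i < n) v 0 i ^+ 2.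
Proof. by rewrite sqr_sqrtr// sumr_ge0// => i _; exact: sqr_ge0. Qed.

(** Strong convexity of the squared distance to [y], as an equality: the last
    term is what makes a proximal objective grow quadratically. *)
Lemma sqr_norm2_conv (R : realType) (n : nat) (t : R) (x z y : 'rV[R]_n) :
  norm2 (t *: x + (1 - t) *: z - y) ^+ 2 =
  t * norm2 (x - y) ^+ 2 + (1 - t) * norm2 (z - y) ^+ 2
    - t * (1 - t) * norm2 (x - z) ^+ 2.
Proof.
rewrite !sqr_norm2 !mulr_sumr -big_split/= -sumrB; apply: eq_bigr => i _.
by rewrite !mxE; ring.
Qed.

Lemma sqr_norm2_row_mx (R : realType) (n m : nat)
    (u : 'rV[R]_n) (v : 'rV[R]_m) :
  norm2 (row_mx u v) ^+ 2 = norm2 u ^+ 2 + norm2 v ^+ 2.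
Proof.
rewrite !sqr_norm2 big_split_ord/=; congr (_ + _); apply: eq_bigr => i _.
  by rewrite row_mxEl.
by rewrite row_mxEr.
Qed.

(** * Convexity of the epigraph *)

Lemma epigraph_conv {R : realType} {n : nat} {f : 'rV[R]_n -> \bar R}
    (fconvex : ereal_convex f) {t : R} {x y : 'rV[R]_n} {r s : R} :
  0 <= t <= 1 -> (f x <= r%:E)%E -> (f y <= s%:E)%E ->
  (f (t *: x + (1 - t) *: y)%R <= (t * r + (1 - t) * s)%:E)%E.
Proof.
move=> t01 fxr fys.
have := fconvex (x, r : R^o) (y, s : R^o) (Itv01 (andP t01).1 (andP t01).2).
by rewrite !inE => /(_ fxr fys).
Qed.

(** Jensen's inequality for uniform weights, with the values of [f] replaced
    by real upper bounds so that no sum of infinities arises. *)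
Lemma epigraph_avg {R : realType} {n : nat} {f : 'rV[R]_n -> \bar R}
    {u : nat -> 'rV[R]_n} {r : nat -> R} {k : nat} :
  ereal_convex f -> (0 < k)%N -> (forall i, f (u i) <= (r i)%:E)%E ->
  (f (k%:R^-1 *: \sum_(0 <= i < k) u i)%R
     <= (k%:R^-1 * \sum_(0 <= i < k) r i)%:E)%E.
Proof.
move=> fconvex + fur; case: k => // k _; elim: k => [|k IHk].
  by rewrite !big_nat1 invr1 scale1r mul1r.
(* The mean of k + 2 terms is the mean of the first k + 1, with weight
   (k + 1) / (k + 2), combined with the last term. *)
pose t : R := k.+1%:R / k.+2%:R.
have k2 : k.+2%:R != 0 :> R by rewrite pnatr_eq0.
have k1 : k.+1%:R != 0 :> R by rewrite pnatr_eq0.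
have tc : t * k.+1%:R^-1 = k.+2%:R^-1 by rewrite /t mulrAC divff ?mul1r.
have t1 : 1 - t = k.+2%:R^-1.
  by apply: (mulIf k2); rewrite mulrBl mul1r divfK// mulVf// -natrB// subSnn.
have t01 : 0 <= t <= 1.
  by rewrite divr_ge0//= ler_pdivrMr ?ltr0n// mul1r ler_nat leqnSn.
have := epigraph_conv fconvex t01 IHk (fur k.+1).
rewrite scalerA mulrA tc t1 -scalerDr -mulrDr.
by rewrite -!(big_nat_recr k.+1 0)//.
Qed.

(** * One proximal step *)

(** The three-point inequality of the proximal map. Comparing the minimizer
    [x'] with the points [t x + (1 - t) x'] and letting [t] tend to [0] gives
    the first-order optimality condition directly, without requiring a
    subgradient of the extended-valued [f]. *)
Lemma prox_gap {R : realType} {n : nat} {f : 'rV[R]_n -> \bar R}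
    {a c : R} {y x' : 'rV[R]_n} :
  ereal_convex f -> 0 < a -> f x' = c%:E ->
  (forall x, (c + a * norm2 (x' - y) ^+ 2)%:E
               <= f x + (a * norm2 (x - y) ^+ 2)%:E)%E ->
  forall x, ((c - a * (norm2 (x - y) ^+ 2 - norm2 (x' - y) ^+ 2
                        - norm2 (x - x') ^+ 2))%:E <= f x)%E.
Proof.
move=> fconvex a0 fx' x'min x.
set D := (_ - _ - _); set W := norm2 (x - x') ^+ 2.
suff bound r : (f x <= r%:E)%E -> c - a * D <= r.
  case: (f x) bound => [s| |] bound; last 2 first.
  - exact: leey.
  - by have := bound (c - a * D - 1) (leNye _); rewrite lerBrDr gerDl ler10.
  by rewrite lee_fin bound.
move=> fxr; rewrite leNgt; apply/negP => ltr.
have W0 : 0 <= a * W by rewrite mulr_ge0 ?sqr_ge0// ltW.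
pose g := c - a * D - r.
have g0 : 0 < g by rewrite subr_gt0.
(* Minimality along the segment yields g <= t a W for every t in (0, 1];
   this t violates it. *)
pose t := g / (g + a * W).
have gW0 : 0 < g + a * W by exact: ltr_wpDr.
have t0 : 0 < t by exact: divr_gt0.
have t01 : 0 <= t <= 1 by rewrite (ltW t0) /t ler_pdivrMr// mul1r lerDl.
have tE : t * (g + a * W) = g by rewrite divfK// gt_eqF.
have fx'c : (f x' <= c%:E)%E by rewrite fx'.
have := le_trans (x'min _) (leeD2r _ (epigraph_conv fconvex t01 fxr fx'c)).
rewrite -EFinD lee_fin sqr_norm2_conv -/W => segment.
have tg : t * g <= t * (t * (a * W)).
  rewrite -subr_ge0.
  rewrite -subr_ge0 in segment.
  suff -> : t * (t * (a * W)) - t * g = t * r + (1 - t) * c +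
    a * (t * norm2 (x - y) ^+ 2 + (1 - t) * norm2 (x' - y) ^+ 2 -
         t * (1 - t) * W) - (c + a * norm2 (x' - y) ^+ 2) by [].
  by rewrite /g /D -/W; ring.
rewrite ler_pM2l// in tg.
have tgt0 : 0 < t * g by rewrite mulr_gt0.
lra.
Qed.

Section PpmStep.
Context {R : realType} {n m : nat} {L : 'rV[R]_n -> 'rV[R]_m -> \bar R}.
Context {eta : R} {y x' : 'rV[R]_n} {w l' : 'rV[R]_m}.

Lemma ppm_step_fin_num :
  ppm_step L eta y w x' l' -> L x' l' \is a fin_num.
Proof.
by case=> _; rewrite /ppm_objective; case: (L x' l').
Qed.

(** [prox_gap] for [L(., l')] and for [- L(x', .)]. The squared displacement
    of the step is dropped from the result, the squared distance to the new
    iterate is kept because it is what telescopes. *)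
Lemma ppm_step_gap :
  (forall l, ereal_convex (L ^~ l)) -> (forall x, ereal_concave (L x)) ->
  0 < eta -> ppm_step L eta y w x' l' ->
  exists c : R, forall x l,
    ((c - 1 / (2 * eta) * (norm2 (x - y) ^+ 2 - norm2 (x - x') ^+ 2))%:E
       <= L x l')%E /\
    (L x' l <=
     (c + 1 / (2 * eta) * (norm2 (l - w) ^+ 2 - norm2 (l - l') ^+ 2))%:E)%E.
Proof.
move=> Lconvex Lconcave eta0 step.
have [c Lc] : exists c, L x' l' = c%:E.
  by exists (fine (L x' l')); rewrite fineK// ppm_step_fin_num.
have [saddle _] := step; move: saddle; rewrite /saddle_point /ppm_objective.
set a := 1 / (2 * eta) => saddle.
have a0 : 0 < a by rewrite divr_gt0// mulr_gt0.
exists c => x l; split.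
- have x'min z : ((c + a * norm2 (x' - y) ^+ 2)%:E
                   <= L z l' + (a * norm2 (z - y) ^+ 2)%:E)%E.
    by have [_] := saddle z l'; rewrite Lc leeD2rE.
  apply: le_trans (prox_gap (Lconvex l') a0 Lc x'min x).
  rewrite lee_fin lerD2l lerN2 ler_pM2l//.
  have := sqr_ge0 (norm2 (x' - y)); lra.
- have l'min z : ((- c + a * norm2 (l' - w) ^+ 2)%:E
                   <= - L x' z + (a * norm2 (z - w) ^+ 2)%:E)%E.
    have [+ _] := saddle x' z; rewrite Lc.
    by case: (L x' z) => [s| |]//; rewrite -?EFinN -?EFinD ?lee_fin ?leey//; lra.
  have Lc' : (- L x' l' = (- c)%:E)%E by rewrite Lc.
  have := prox_gap (Lconcave x') a0 Lc' l'min l.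
  rewrite leeNr => /le_trans; apply.
  rewrite -EFinN lee_fin.
  have := mulr_ge0 (ltW a0) (sqr_ge0 (norm2 (l' - w))); lra.
Qed.

End PpmStep.

(** * Summing the steps *)

Lemma sum_telescope_decr (R : realType) (a : R) (c g : nat -> R) (k : nat) :
  \sum_(0 <= i < k) (c i + a * (g i - g i.+1)) =
  \sum_(0 <= i < k) c i + a * (g 0%N - g k).
Proof.
rewrite big_split/= -mulr_sumr; congr (_ + a * _).
by rewrite -opprB -telescope_sumr// -sumrN; apply: eq_bigr => i _; rewrite opprB.
Qed.

Theorem corollary1 (R : realType) (n m : nat)
  (L : 'rV[R]_n -> 'rV[R]_m -> \bar R)
  (Lconvex : forall l : 'rV[R]_m, ereal_convex (fun x => L x l))
  (Llsc : forall l : 'rV[R]_m, lower_semicontinuous (fun x => L x l))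
  (Lconcave : forall x : 'rV[R]_n, ereal_concave (fun l => L x l))
  (Lusc : forall x : 'rV[R]_n, upper_semicontinuous (fun l => L x l))
  (eta : R) (eta_gt0 : 0 < eta)
  (xs : nat -> 'rV[R]_n) (ls : nat -> 'rV[R]_m)
  (ppm : forall k : nat, ppm_step L eta (xs k) (ls k) (xs k.+1) (ls k.+1)) :
  forall (k : nat), (1 <= k)%N ->
  forall (x : 'rV[R]_n) (l : 'rV[R]_m),
    (L (avg_iter xs k) l +? - L x (avg_iter ls k))%E /\
    (L (avg_iter xs k) l - L x (avg_iter ls k) <=
     (norm2 (row_mx x l - row_mx (xs 0%N) (ls 0%N)) ^+ 2
        / (2 * eta * k%:R))%:E)%E.
Proof.
move=> k k0 x l.
have [c gap] := choice (fun i =>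
  ppm_step_gap Lconvex Lconcave eta_gt0 (ppm i)).
rewrite /avg_iter !big_add1/=.
set xbar := _ *: _; set lbar := _ *: _.
set a := 1 / (2 * eta) in gap.
pose gx i := norm2 (x - xs i) ^+ 2; pose gl i := norm2 (l - ls i) ^+ 2.
have a0 : 0 < a by rewrite divr_gt0// mulr_gt0.
have upper : (L xbar l <=
    (k%:R^-1 * (\sum_(0 <= i < k) c i + a * (gl 0%N - gl k)))%:E)%E.
  rewrite -sum_telescope_decr.
  by apply: (epigraph_avg (Lconvex l) k0) => i; have [] := gap i x l.
have lower : (- L x lbar <=
    (k%:R^-1 * (\sum_(0 <= i < k) - c i + a * (gx 0%N - gx k)))%:E)%E.
  rewrite -sum_telescope_decr.
  apply: (epigraph_avg (Lconcave x) k0) => i.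
  have [+ _] := gap i x l; rewrite -leeN2 => /le_trans; apply.
  by rewrite -EFinN lee_fin opprB addrC.
split.
  by move: upper lower; case: (L xbar l) => [?| |]//; case: (L x lbar).
apply: le_trans (leeD upper lower) _.
rewrite -EFinD lee_fin opp_row_mx add_row_mx sqr_norm2_row_mx.
rewrite -/(gx 0%N) -/(gl 0%N) sumrN.
have kR : 0 < k%:R^-1 :> R by rewrite invr_gt0 ltr0n.
have -> : (gx 0%N + gl 0%N) / (2 * eta * k%:R)
          = k%:R^-1 * (a * (gx 0%N + gl 0%N)).
  by rewrite /a invfM; ring.
rewrite -mulrDr ler_pM2l//.
have := mulr_ge0 (ltW a0) (sqr_ge0 (norm2 (x - xs k))).
have := mulr_ge0 (ltW a0) (sqr_ge0 (norm2 (l - ls k))).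
rewrite -/(gx k) -/(gl k); lra.
Qed.
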